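(* Let $G$ be a finite simple graph with at least one edge, and let $\beta > 2$ be a rational number. Then $$\left\lceil \frac{\log \chi_f(G)}{\log \beta} \right\rceil \;\leq\; c_{\{\chi_f \leq \beta\}}(G) \;\leq\; \left\lceil \frac{\log \chi(G)}{\log \omega(G)} \right\rceil \cdot \left\lceil \frac{\log\chi_f(G)}{\log \left\lfloor \beta \right\rfloor} \right\rceil .$$
   Context: All graphs are finite, undirected and simple; logarithms are to base two. $\chi(G)$ is the chromatic number and $\omega(G)$ the clique number (size of the largest complete subgraph). For integers $n \geq 2k \geq 2$, the Kneser graph $KG(n,k)$ has as vertices the $k$-element subsets of $\{1,\dots,n\}$, two being adjacent iff they are disjoint. The fractional chromatic number $\chi_f(G)$ of a graph $G$ with at least one edge is the smallest value of $n/k$ over all $n \ge 2k\ge 2$ such that there is a graph homomorphism $G \to KG(n,k)$ (this agrees with the usual fractional chromatic number; edgeless nonempty graphs have $\chi_f = 1$). For a rational number $\beta$, $\{\chi_f \leq \beta\}$ denotes the class of all graphs $H$ with $\chi_f(H) \leq \beta$. For a graph class $\mathcal P$ containing $K_2$, the cover number $c_{\mathcal P}(G)$ is the smallest positive integer $c$ such that there are subgraphs $G_1,\dots,G_c$ of $G$, each belonging to $\mathcal P$, with $E(G) = E(G_1)\cup\dots\cup E(G_c)$ (the subgraphs need not be edge-disjoint). *)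

(* Defs.v *)
From HB Require Import structures.
From mathcomp Require Import all_boot all_order all_algebra.
From mathcomp Require Import all_classical all_reals all_analysis.

Set Implicit Arguments.
Unset Strict Implicit.
Unset Printing Implicit Defensive.

Import Order.TTheory GRing.Theory Num.Theory.

Local Open Scope classical_set_scope.
Local Open Scope ring_scope.

(* The least element of S; the default x0 is returned only when S has none. *)
Definition least d (T : porderType d) (x0 : T) (S : set T) : T :=
  xget x0 (S `&` lbound S).

Record graph := Graph {
  vertex :> finType;
  adj : rel vertex;
  adj_sym : symmetric adj;
  adj_irr : irreflexive adj }.

Definition has_edge (G : graph) : bool := [exists x : G, exists y : G, adj x y].

Definition hom (G H : graph) : Prop :=
  exists f : G -> H, forall x y : G, adj x y -> adj (f x) (f y).

Definition proper_coloring (G : graph) (m : nat) (f : G -> 'I_m) : Prop :=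
  forall x y : G, adj x y -> f x != f y.

Definition chromatic_number (G : graph) : nat :=
  least 0%N [set m | exists f : G -> 'I_m, proper_coloring f].

Definition clique (G : graph) (A : {set G}) : bool :=
  [forall x in A, forall y in A, (x != y) ==> adj x y].

Definition clique_number (G : graph) : nat :=
  (\max_(A : {set G} | clique A) #|A|)%N.

Section Kneser.
Variables n k : nat.

Definition kneser_vertex : finType := {A : {set 'I_n} | #|A| == k}.

(* For k > 0 disjoint k-subsets are distinct; the condition A != B only
   matters for k = 0, where it keeps the relation irreflexive. *)
Definition kneser_adj : rel kneser_vertex :=
  fun A B => (A != B) && [disjoint val A & val B].

Lemma kneser_adj_sym : symmetric kneser_adj.
Proof. by move=> A B; rewrite /kneser_adj eq_sym disjoint_sym. Qed.

Lemma kneser_adj_irr : irreflexive kneser_adj.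
Proof. by move=> A; rewrite /kneser_adj eqxx. Qed.

Definition kneser : graph := Graph kneser_adj_sym kneser_adj_irr.
End Kneser.

(* The values n / k for which G has a homomorphism to KG(n, k). *)
Definition kneser_ratios (G : graph) : set rat :=
  [set q | exists n k : nat,
     [/\ (1 <= k)%N, (2 * k <= n)%N, hom G (kneser n k) & q = n%:R / k%:R]].

(* The minimum is attained for every G with an edge. KG(n, k) with n >= 2k
   always has ratio at least 2, hence the separate value 1 for edgeless
   nonempty graphs; the graph without vertices gets the value 0. *)
Definition fractional_chromatic_number (G : graph) : rat :=
  if has_edge G then least 0 (kneser_ratios G) else (0 < #|G|)%N%:R.

Record subgraph (G : graph) := Subgraph {
  sub_vertices : {set G};
  sub_adj : rel G;
  sub_adj_sym : symmetric sub_adj;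
  sub_adjP : forall x y, sub_adj x y ->
    [&& x \in sub_vertices, y \in sub_vertices & adj x y] }.

Section SubgraphGraph.
Variables (G : graph) (H : subgraph G).

Definition subgraph_vertex : finType := {x : G | x \in sub_vertices H}.

Definition subgraph_adj : rel subgraph_vertex :=
  fun x y => sub_adj H (val x) (val y).

Lemma subgraph_adj_sym : symmetric subgraph_adj.
Proof. by move=> x y; rewrite /subgraph_adj sub_adj_sym. Qed.

Lemma subgraph_adj_irr : irreflexive subgraph_adj.
Proof.
by move=> x; apply/negP => /sub_adjP /and3P[_ _]; rewrite adj_irr.
Qed.

Definition graph_of_subgraph : graph :=
  Graph subgraph_adj_sym subgraph_adj_irr.
End SubgraphGraph.

Coercion graph_of_subgraph : subgraph >-> graph.

Definition covered_by (P : graph -> Prop) (G : graph) (c : nat) : Prop :=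
  exists H : 'I_c -> subgraph G,
    (forall i, P (H i)) /\
    (forall x y : G, adj x y <-> exists i, sub_adj (H i) x y).

Definition cover_number (P : graph -> Prop) (G : graph) : nat :=
  least 0%N [set c | (0 < c)%N /\ covered_by P G c].

Definition chif_le (beta : rat) : graph -> Prop :=
  fun H => fractional_chromatic_number H <= beta.

Definition log2 (R : realType) (x : R) : R := ln x / ln 2.

(* Main.v *)
Require Import Defs.
From mathcomp Require Import all_boot all_order all_algebra.
From mathcomp Require Import all_classical all_reals all_analysis.
From mathcomp Require Import lra.

Set Implicit Arguments.
Unset Strict Implicit.
Unset Printing Implicit Defensive.

Import Order.TTheory GRing.Theory Num.Theory.

Local Open Scope ring_scope.

(** Write [chi], [omega], [chif] for the three parameters of [G].

    Lower bound. If [G] is the union of [c] graphs with set colorings of ratios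
    [n_i / k_i <= beta], then coloring each vertex by the product of its [c]
    color sets is a set coloring of [G] of ratio [\prod_i n_i / k_i], since the
    products are disjoint as soon as they are so in one coordinate. Hence
    [chif <= beta ^ c] ([chif_le_expn_cover]).

    Upper bound. Put [b := floor beta], which is at least 2. If [chi <= b ^ c],
    then writing the colors of an optimal coloring with [c] digits in base [b]
    covers [G] by [c] graphs that are [b]-colorable, hence of fractional
    chromatic number at most [b <= beta] ([covered_by_digits]). It remains to
    see that the product [c] of the two ceilings is large enough, and this
    follows from [omega <= chif]:
    [ln chi <= ceil (ln chi / ln omega) * ln omega], while
    [ln omega <= ln chif <= ceil (ln chif / ln b) * ln b].

    Both halves use that the minimum defining [chif] exists ([chif_attained]).
    Set colorings of ratio [q] correspond to rational weightings of the stable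
    sets of mass [q] that cover each vertex with total weight exactly 1, so the
    claim is that this linear program has a rational minimizer. Every feasible
    point can be moved, without increasing its mass, to a vertex of the
    polyhedron, and there are finitely many vertices because a vertex is
    determined by its support ([exists_minimizer]). *)

Lemma least_eq d (T : porderType d) (x0 x : T) (S : set T) :
  S x -> lbound S x -> least x0 S = x.
Proof.
move=> Sx lx; rewrite /least; case: xgetP => [y _ [Sy ly]|/(_ x)]; last by case.
by apply/le_anti/andP; split; [apply: ly|apply: lx].
Qed.

(** * Minimizers of linear programs *)

Definition affine_closed (T : finType) (F : pzRingType)
    (P : {ffun T -> F} -> Prop) : Prop :=
  forall w1 w2 t, P w1 -> P w2 -> P [ffun i => w1 i + t * (w2 i - w1 i)].

Definition mass (T : finType) (F : pzRingType) (w : {ffun T -> F}) : F :=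
  \sum_i w i.

Definition feasible (T : finType) (F : realFieldType)
    (P : {ffun T -> F} -> Prop) (w : {ffun T -> F}) : Prop :=
  P w /\ forall i, 0 <= w i.

Definition supp (T : finType) (F : realFieldType) (w : {ffun T -> F}) :
  {set T} := [set i | w i != 0].

(** The vertices of the polyhedron of feasible points, characterized as
    the feasible points that are the only one supported in their support. *)
Definition rigid (T : finType) (F : realFieldType)
    (P : {ffun T -> F} -> Prop) (w : {ffun T -> F}) : Prop :=
  feasible P w /\
  forall w', feasible P w' -> supp w' \subset supp w -> w' = w.

(** Walk from [w] in the direction [z] until a coordinate vanishes. One must
    vanish: a nonzero direction without negative coordinates would increase the
    mass. *)
Lemma shrink_support (T : finType) (F : realFieldType)
    (P : {ffun T -> F} -> Prop) (w z : {ffun T -> F}) :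
    (forall t, P [ffun i => w i + t * z i]) -> (forall i, 0 <= w i) ->
    supp z \subset supp w -> (exists i, z i != 0) -> mass z <= 0 ->
  exists w', [/\ feasible P w', mass w' <= mass w & supp w' \proper supp w].
Proof.
move=> Pz w0 szw [i1 zi1] z0.
have [i0 zi0] : exists i, z i < 0.
  apply/existsP; apply: contraNT zi1 => /existsPn zge.
  have zge0 i : true -> 0 <= z i by rewrite leNgt zge.
  have /eqP : \sum_i z i = 0 by apply/le_anti; rewrite z0 sumr_ge0.
  by rewrite psumr_eq0// => /allP/(_ i1 (mem_index_enum _)).
(* the first time at which a coordinate reaches zero *)
case: (@arg_minP _ F _ i0 (fun i => z i < 0) (fun i => w i / - z i) zi0).
move=> i zi imin.
set t := w i / - z i in imin *.
have t0 : 0 <= t by rewrite divr_ge0// oppr_ge0 ltW.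
exists [ffun j => w j + t * z j]; split.
- split=> // j; rewrite ffunE; have [zj|zj] := leP 0 (z j).
    by rewrite addr_ge0// mulr_ge0.
  have := imin j zj; rewrite ler_pdivlMr ?oppr_gt0// mulrN.
  by rewrite -subr_ge0 opprK.
- rewrite /mass (eq_bigr (fun j => w j + t * z j)); last first.
    by move=> j; rewrite ffunE.
  by rewrite big_split -mulr_sumr/= gerDl mulr_ge0_le0.
- apply/properP; split.
    apply/fintype.subsetP => j; rewrite !inE ffunE; apply: contraNN => /eqP wj.
    have : j \notin supp w by rewrite inE wj eqxx.
    by move=> /(contra (fintype.subsetP szw j)); rewrite inE negbK wj => /eqP->;
      rewrite mulr0 addr0.
  exists i; first by apply: (fintype.subsetP szw); rewrite inE lt_eqF.
  rewrite inE ffunE negbK /t invrN mulrN mulNr divfK ?subrr//.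
  by rewrite lt_eqF.
Qed.

(** The support of a feasible point that is not a vertex contains the support of
    another one. Following the line through both, in the direction that does not increase
    the mass, leads to a feasible point of smaller support. *)
Lemma exists_rigid_le (T : finType) (F : realFieldType)
    (P : {ffun T -> F} -> Prop) (w : {ffun T -> F}) :
    affine_closed P -> feasible P w ->
  exists2 w', rigid P w' & mass w' <= mass w.
Proof.
move=> Paff; have [n] := ubnP #|supp w|; elim: n w => // n IHn w ltwn Fw.
have [Rw|nRw] := pselect (rigid P w); first by exists w.
have [w' Fw' [sw' w'w]] : exists2 w', feasible P w' &
    supp w' \subset supp w /\ w' <> w.
  apply: contrapT => nex; apply: nRw; split=> // w' Fw' sw'.
  by apply: contrapT => w'w; apply: nex; exists w'.
have {}w'w : exists i, w' i != w i.
  apply/existsP; apply: contrapT => /negP/existsPn w'w_eq.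
  by apply: w'w; apply/ffunP => i; apply/eqP/negPn/w'w_eq.
have sub i : w i = 0 -> w' i = 0.
  move=> wi; apply/eqP; apply: contraTT sw' => w'i; apply/subsetPn.
  by exists i; rewrite inE ?w'i// wi eqxx.
(* [e] selects the orientation of the line *)
pose z e : {ffun T -> F} := [ffun i => (-1) ^+ e * (w' i - w i)].
have [e ze] : exists e : bool, mass (z e) <= 0.
  have tz e : mass (z e) = (-1) ^+ e * (mass w' - mass w).
    rewrite /mass -sumrB mulr_sumr; apply: eq_bigr => i _.
    by rewrite ffunE.
  have [le|lt] := leP (mass w') (mass w).
    by exists false; rewrite tz mul1r subr_le0.
  by exists true; rewrite tz expr1 mulN1r oppr_le0 subr_ge0 ltW.
have [|i|||w'' [Fw'' le'' ss'']] := @shrink_support T F P w (z e) _ _ _ _ ze.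
- move=> t; have := Paff w w' (t * (-1) ^+ e) (proj1 Fw) (proj1 Fw').
  by congr P; apply/ffunP => i; rewrite !ffunE mulrA.
- exact: (proj2 Fw).
- apply/fintype.subsetP => i; rewrite !inE ffunE; apply: contraNN => /eqP wi.
  by rewrite wi sub// subrr mulr0.
- case: w'w => i w'wi; exists i.
  by rewrite ffunE mulf_neq0 ?signr_eq0 ?subr_eq0.
have [|v Rv lev] := IHn w'' _ Fw''; last first.
  by exists v => //; apply: le_trans le''.
exact: leq_trans (proper_card ss'') ltwn.
Qed.

(** A vertex is determined by its support, so there are finitely many of them,
    and every feasible point is dominated by one. *)
Lemma exists_minimizer (T : finType) (F : realFieldType)
    (P : {ffun T -> F} -> Prop) (w0 : {ffun T -> F}) :
    affine_closed P -> feasible P w0 ->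
  exists2 w, feasible P w & forall w', feasible P w' -> mass w <= mass w'.
Proof.
move=> Paff /(exists_rigid_le Paff)[r0 Rr0 _].
pose vtx (J : {set T}) := xget r0 [set w | rigid P w /\ supp w = J]%classic.
have vtxE r : rigid P r -> vtx (supp r) = r.
  move=> Rr; rewrite /vtx; case: xgetP => [w _ [Rw sw]|/(_ r)]; last by case.
  by apply: (proj2 Rr); rewrite ?sw//; case: Rw.
pose Q J := `[<rigid P (vtx J)>].
have Q0 : Q (supp r0) by apply/asboolP; rewrite vtxE.
case: (arg_minP (fun J => mass (vtx J)) Q0) => J /asboolP[FJ _] Jmin.
exists (vtx J) => // w' /(exists_rigid_le Paff)[r Rr]; apply: le_trans.
by have := Jmin (supp r); rewrite vtxE//; apply; apply/asboolP; rewrite vtxE.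
Qed.

(** * The fractional chromatic number is attained *)

(** A map to the Kneser graph on the colors [T] with color sets of size [k];
    leaving the type [T] free allows products and sums of color types. *)
Definition set_coloring (G : graph) (T : finType) (k : nat)
    (F : G -> {set T}) : Prop :=
  (forall v, #|F v| = k) /\ forall x y : G, adj x y -> [disjoint F x & F y].

Lemma set_coloring_card (G : graph) (T : finType) (k : nat)
    (F : G -> {set T}) : has_edge G -> set_coloring k F -> (2 * k <= #|T|)%N.
Proof.
move=> /existsP[x /existsP[y xy]] [Fk Fd].
have [_] := leq_card_setU (F x) (F y).
by rewrite Fd// !Fk mul2n -addnn => /eqP <-; apply: max_card.
Qed.

Lemma kneser_ratio_of_coloring (G : graph) (T : finType) (k : nat)
    (F : G -> {set T}) : has_edge G -> (0 < k)%N -> set_coloring k F ->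
  kneser_ratios G (#|T|%:R / k%:R).
Proof.
move=> eG k0 FF; have [Fk Fd] := FF.
exists #|T|, k; split=> //; first exact: set_coloring_card FF.
have Ek v : #|[set enum_rank t | t in F v]| == k.
  by rewrite card_imset ?Fk//; exact: enum_rank_inj.
exists (fun v => exist (fun A : {set 'I_#|T|} => #|A| == k) _ (Ek v)) => x y.
move=> /Fd dxy.
have disj :
    [disjoint [set enum_rank t | t in F x] & [set enum_rank t | t in F y]].
  by rewrite imset_disjoint//; exact: enum_rank_inj.
apply/andP; split => //; apply: contraTneq k0 => /(congr1 val)/= xy.
move: disj; rewrite -xy -setI_eq0 finset.setIid -cards_eq0 (eqP (Ek x)).
by move=> /eqP->.
Qed.

Lemma coloring_of_kneser_ratio (G : graph) (q : rat) : kneser_ratios G q ->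
  exists n k (F : G -> {set 'I_n}),
    [/\ (0 < k)%N, set_coloring k F & q = n%:R / k%:R].
Proof.
move=> [n [k [k0 _ [f hf] ->]]]; exists n, k, (fun v => val (f v)); split=> //.
split=> [v|x y /hf/andP[]//]; exact/eqP/(valP (f v)).
Qed.

Lemma kneser_ratios_nonempty (G : graph) :
  has_edge G -> kneser_ratios G (#|G|%:R / 1%:R).
Proof.
move=> eG; apply: (@kneser_ratio_of_coloring G G 1 (fun v => [set v])) => //.
split=> [v|x y xy]; first exact: cards1.
rewrite disjoints1 inE; apply: contraTneq xy => ->.
by rewrite adj_irr.
Qed.

Definition stable (G : graph) (I : {set G}) : bool :=
  [forall x in I, forall y in I, ~~ adj x y].

(** The weights of the linear program for the fractional chromatic number, with
    each vertex covered exactly: this is what a map to a Kneser graph yields,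
    and it keeps the constraints affine. *)
Definition stable_weighting (G : graph) (w : {ffun {set G} -> rat}) : Prop :=
  (forall I, ~~ stable I -> w I = 0) /\
  forall v, \sum_(I : {set G} | v \in I) w I = 1.

Lemma stable_weighting_affine (G : graph) :
  affine_closed (@stable_weighting G).
Proof.
move=> w1 w2 t [s1 c1] [s2 c2]; split=> [I nI|v].
  by rewrite ffunE s1// s2// subrr mulr0 addr0.
rewrite (eq_bigr (fun I => w1 I + t * (w2 I - w1 I))); last first.
  by move=> I _; rewrite ffunE.
by rewrite big_split/= c1 -mulr_sumr sumrB c1 c2 subrr mulr0 addr0.
Qed.

Lemma sum_card_fibers (A T : finType) (f : T -> A) (Q : pred A) :
  (\sum_(a | Q a) #|[set t | f t == a]| = #|[set t | Q (f t)]|)%N.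
Proof.
rewrite -[RHS]sum1_card (partition_big f Q)/=; last by move=> t; rewrite inE.
apply: eq_bigr => a Qa; rewrite -sum1_card; apply: eq_bigl => t.
by rewrite !inE; case: eqP => [->|]; rewrite ?Qa ?andbF.
Qed.

(** Each color contributes weight [1 / k] to the stable set of the vertices that
    receive it. *)
Lemma weighting_of_coloring (G : graph) (T : finType) (k : nat)
    (F : G -> {set T}) : (0 < k)%N -> set_coloring k F ->
  exists2 w, feasible (@stable_weighting G) w & mass w = #|T|%:R / k%:R.
Proof.
move=> k0 [Fk Fd]; pose cls t := [set v | t \in F v].
pose w : {ffun {set G} -> rat} :=
  [ffun I => #|[set t | cls t == I]|%:R / k%:R].
have sumw (Q : pred {set G}) :
    \sum_(I | Q I) w I = #|[set t | Q (cls t)]|%:R / k%:R.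
  rewrite -sum_card_fibers natr_sum mulr_suml.
  by apply: eq_bigr => I _; rewrite ffunE.
exists w; last by rewrite /mass sumw cardsE.
split=> [|I]; last by rewrite ffunE divr_ge0.
split=> [I nI|v].
  rewrite ffunE; suff -> : [set t | cls t == I] = finset.set0.
    by rewrite cards0 mul0r.
  apply/setP => t; rewrite !inE; apply: contraNF nI => /eqP <-.
  apply/forall_inP => x; rewrite inE => tx.
  apply/forall_inP => y; rewrite inE => ty.
  by apply/negP => /Fd/disjointFr/(_ tx); rewrite ty.
rewrite sumw; suff -> : [set t | v \in cls t] = F v.
  by rewrite Fk divff// pnatr_eq0 -lt0n.
by apply/setP => t; rewrite !inE.
Qed.

Lemma common_denominator (T : finType) (w : T -> rat) :
    (forall i, 0 <= w i) ->
  exists k (m : T -> nat), (0 < k)%N /\ forall i, w i = (m i)%:R / k%:R.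
Proof.
move=> w0; exists (\prod_i `|denq (w i)|)%N.
exists (fun i => `|numq (w i)| * \prod_(j | j != i) `|denq (w j)|)%N.
split=> [|i]; first by rewrite prodn_gt0// => i; rewrite absz_gt0 denq_neq0.
rewrite [X in _ / X%:R](bigD1 i)//= !natrM -mulf_div divff ?mulr1; last first.
  by rewrite pnatr_eq0 -lt0n prodn_gt0// => j; rewrite absz_gt0 denq_neq0.
by rewrite !natr_absz !ger0_norm ?denq_ge0 ?numq_ge0// divq_num_den.
Qed.

(** Clear denominators and use [m I] private colors for each stable set [I]. *)
Lemma coloring_of_weighting (G : graph) (w : {ffun {set G} -> rat}) :
    feasible (@stable_weighting G) w ->
  exists (T : finType) (k : nat) (F : G -> {set T}),
    [/\ (0 < k)%N, set_coloring k F & mass w = #|T|%:R / k%:R].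
Proof.
move=> [[ws wc] w0]; have [k [m [k0 wE]]] := common_denominator w0.
pose T : finType := {I : {set G} & 'I_(m I)}.
have cardT (Q : pred {set G}) :
    #|[set c : T | Q (tag c)]|%:R / k%:R = \sum_(I | Q I) w I.
  rewrite (eq_bigr (fun I => (m I)%:R / k%:R)); last by move=> I _; exact: wE.
  rewrite -mulr_suml -natr_sum; congr (_%:R / _).
  under eq_bigr => I _ do rewrite -[m I]card_ord -sum1_card.
  rewrite sig_big_dep -sum1_card; apply: eq_bigl => c.
  by rewrite inE andbT.
exists T, k, (fun v : G => [set c : T | v \in tag c]); split=> //; last first.
  by rewrite /mass -(cardT predT) cardsE.
split=> [v|x y xy].
  have := cardT (fun I => v \in I); rewrite wc => /(divr1_eq)/eqP.
  by rewrite eqr_nat => /eqP.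
rewrite -setI_eq0; apply/eqP/setP => -[I i]; rewrite !inE/=.
apply/negP => /andP[xI yI].
have : w I != 0.
  by rewrite wE mulf_neq0 ?invr_eq0 ?pnatr_eq0 -?lt0n//
    (leq_ltn_trans _ (ltn_ord i)).
rewrite ws ?eqxx//; apply/forall_inPn; exists x => //.
by apply/forall_inPn; exists y => //; rewrite negbK.
Qed.

(** The default value in the definition of the fractional chromatic number is
    never used for a graph with an edge. *)
Lemma chif_attained (G : graph) : has_edge G ->
  kneser_ratios G (fractional_chromatic_number G) /\
  lbound (kneser_ratios G) (fractional_chromatic_number G).
Proof.
move=> eG; rewrite /fractional_chromatic_number eG.
have weighting q : kneser_ratios G q ->
    exists2 w, feasible (@stable_weighting G) w & mass w = q.
  move=> /coloring_of_kneser_ratio[n [k [F [k0 FF ->]]]].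
  by have := weighting_of_coloring k0 FF; rewrite card_ord.
have [w0 Fw0 _] := weighting _ (kneser_ratios_nonempty eG).
have [w Fw wmin] := exists_minimizer (@stable_weighting_affine G) Fw0.
have rw : kneser_ratios G (mass w).
  have [T [k [F [k0 FF ->]]]] := coloring_of_weighting Fw.
  exact: kneser_ratio_of_coloring FF.
have lw : lbound (kneser_ratios G) (mass w).
  by move=> q /weighting[w' /wmin + <-].
by rewrite (least_eq 0 rw lw).
Qed.

(** * Bounds on the fractional chromatic number *)

Lemma chif_le_ratio (G : graph) (T : finType) (k : nat) (F : G -> {set T}) :
    has_edge G -> (0 < k)%N -> set_coloring k F ->
  fractional_chromatic_number G <= #|T|%:R / k%:R.
Proof.
move=> eG k0 /(kneser_ratio_of_coloring eG k0).
exact: (chif_attained eG).2.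
Qed.

Lemma chif_ge2 (G : graph) : has_edge G -> 2 <= fractional_chromatic_number G.
Proof.
move=> eG; have [[n [k [k0 kn _ ->]]] _] := chif_attained eG.
by rewrite ler_pdivlMr ?ltr0n// -natrM ler_nat.
Qed.

(** The color sets of the vertices of a clique are pairwise disjoint, so they
    use up [k] colors for each vertex. *)
Lemma clique_card_le_chif (G : graph) (A : {set G}) :
  has_edge G -> clique A -> #|A|%:R <= fractional_chromatic_number G.
Proof.
move=> eG /forall_inP cA.
have [/coloring_of_kneser_ratio + _] := chif_attained eG.
move=> [n [k [F [k0 [Fk Fd] ->]]]].
rewrite ler_pdivlMr ?ltr0n// -natrM ler_nat.
(* the empty set off [A] makes the family disjoint over all of [G] *)
pose F' v := if v \in A then F v else finset.set0.
have dF' u v : u != v -> [disjoint F' u & F' v].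
  move=> uv; rewrite /F'; case: ifPn => uA; last first.
    by rewrite -setI_eq0 finset.set0I.
  case: ifPn => vA; last by rewrite -setI_eq0 finset.setI0.
  by apply: Fd; have /forall_inP/(_ v vA)/implyP := cA u uA; apply.
have := partition_disjoint_bigcup addn (fun=> 1%N) dF'; rewrite sum1_card.
under [RHS]eq_bigr => v _ do
  rewrite sum1_card (fun_if (fun B : {set 'I_n} => #|B|)) cards0 Fk.
rewrite -sum_nat_const [leqLHS]big_mkcond => <-.
by rewrite -[leqRHS]card_ord max_card.
Qed.

Lemma clique_number_le_chif (G : graph) :
  has_edge G -> (clique_number G)%:R <= fractional_chromatic_number G.
Proof.
move=> eG; rewrite /clique_number.
apply: (big_ind (fun m : nat => m%:R <= fractional_chromatic_number G)).
- by apply: le_trans (chif_ge2 eG).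
- by move=> a b; rewrite /maxn; case: ifP.
- by move=> A; exact: clique_card_le_chif.
Qed.

Lemma clique_number_ge2 (G : graph) : has_edge G -> (2 <= clique_number G)%N.
Proof.
move=> /existsP[x /existsP[y xy]].
have xDy : x != y by apply: contraTneq xy => ->; rewrite adj_irr.
have -> : 2%N = #|[set x; y]| by rewrite cards2 xDy.
apply: (@leq_bigmax_cond _ _ (fun A : {set G} => #|A|)).
apply/forall_inP => u; rewrite !inE => /orP[]/eqP->;
  apply/forall_inP => v; rewrite !inE => /orP[]/eqP->; rewrite ?eqxx//.
  by rewrite xy implybT.
by rewrite adj_sym xy implybT.
Qed.

(** Color by the products of the color sets: two products are disjoint as soon
    as they are so in one coordinate. *)
Lemma chif_union_le (G : graph) (c : nat) (n k : 'I_c -> nat)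
    (F : forall i : 'I_c, G -> {set 'I_(n i)}) :
    has_edge G -> (forall i, (0 < k i)%N) -> (forall i v, #|F i v| = k i) ->
    (forall x y : G, adj x y -> exists i, [disjoint F i x & F i y]) ->
  fractional_chromatic_number G <= \prod_i ((n i)%:R / (k i)%:R).
Proof.
move=> eG k0 Fk Fd; pose T : finType := {dffun forall i : 'I_c, 'I_(n i)}.
have foldr_prod (f : 'I_c -> nat) :
    foldr muln 1%N [seq f i | i : 'I_c] = (\prod_i f i)%N.
  by rewrite foldrE big_map big_enum.
pose P v : {set T} := [set g : T | g \in family (fun i => mem (F i v))].
have PP : set_coloring (\prod_i k i)%N P.
  split=> [v|x y /Fd[i di]].
    by rewrite cardsE card_family foldr_prod; apply: eq_bigr => i _; exact: Fk.
  rewrite -setI_eq0; apply/eqP/setP => g; rewrite !inE.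
  apply/negP => /andP[/familyP/(_ i) gx /familyP/(_ i) gy].
  by rewrite (disjointFr di gx) in gy.
have := chif_le_ratio eG (prodn_gt0 k0) PP.
rewrite card_dep_ffun foldr_prod !natr_prod -prodf_div.
by under eq_bigr => i _ do rewrite card_ord.
Qed.

(** * Covers *)

(** The values 0 and 1 for edgeless graphs are not ratios of Kneser graphs, but
    an edgeless graph has a set coloring of ratio 1, with a single color. *)
Lemma chif_le_coloring (H : graph) (beta : rat) : 1 <= beta -> chif_le beta H ->
  exists n k (F : H -> {set 'I_n}),
    [/\ (0 < k)%N, n%:R / k%:R <= beta & set_coloring k F].
Proof.
move=> b1; rewrite /chif_le; have [eH|eH] := boolP (has_edge H).
  have [/coloring_of_kneser_ratio[n [k [F [k0 FF ->]]]] _] := chif_attained eH.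
  by move=> lb; exists n, k, F.
move=> _; exists 1%N, 1%N, (fun=> [set ord0]); split; rewrite ?divr1//.
split=> [v|x y xy]; first exact: cards1.
by case/existsP: eH; exists x; apply/existsP; exists y.
Qed.

(** Vertices outside the subgraph are isolated, so any color set will do. *)
Lemma subgraph_coloring (G : graph) (H : subgraph G) (beta : rat) :
    1 <= beta -> chif_le beta H ->
  exists n k (F : G -> {set 'I_n}),
    [/\ (0 < k)%N, n%:R / k%:R <= beta, forall v, #|F v| = k &
        forall x y, sub_adj H x y -> [disjoint F x & F y]].
Proof.
move=> b1 /(chif_le_coloring b1)[n [k [F [k0 nk [Fk Fd]]]]].
have [u|noH] := pickP (mem [set: H]); last first.
  exists 1%N, 1%N, (fun=> [set ord0]); split; rewrite ?divr1//.
    by move=> v; exact: cards1.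
  by move=> x y /sub_adjP/and3P[xH _ _]; have := noH (Sub x xH); rewrite !inE.
move=> _; exists n, k, (fun v => F (insubd u v)); split=> // x y xy.
have /and3P[xH yH _] := sub_adjP xy.
by apply: Fd; rewrite /adj/= /subgraph_adj !insubdK.
Qed.

Lemma chif_le_expn_cover (G : graph) (beta : rat) (c : nat) :
    has_edge G -> 1 <= beta -> Defs.covered_by (chif_le beta) G c ->
  fractional_chromatic_number G <= beta ^+ c.
Proof.
move=> eG b1 [H [Hb Hc]].
have /choice[s sP] i : exists s : {n & (nat * (G -> {set 'I_n}))%type},
    [/\ (0 < (projT2 s).1)%N, (projT1 s)%:R / (projT2 s).1%:R <= beta,
        forall v, #|(projT2 s).2 v| = (projT2 s).1 &
        forall x y, sub_adj (H i) x y ->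
          [disjoint (projT2 s).2 x & (projT2 s).2 y]].
  have [n [k [F FF]]] := subgraph_coloring b1 (Hb i).
  by exists (existT _ n (k, F)).
have : fractional_chromatic_number G <=
    \prod_i ((projT1 (s i))%:R / (projT2 (s i)).1%:R).
  apply: (@chif_union_le G c _ _ (fun i => (projT2 (s i)).2)) => // [i|i v|x y].
  - by case: (sP i).
  - by case: (sP i).
  - by move=> /Hc[i xy]; exists i; case: (sP i) => _ _ _; apply.
move=> /le_trans; apply; rewrite -[c in leRHS]card_ord -prodr_const.
by apply: ler_prod => i _; rewrite divr_ge0//=; case: (sP i).
Qed.

(** Write the colors in base [b]: an edge goes to the [i]-th graph when the
    [i]-th digits of its end colors differ, so each graph is [b]-colorable. *)
Lemma covered_by_digits (G : graph) (beta : rat) (m b c : nat)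
    (f : G -> 'I_m) : 1 <= beta -> b%:R <= beta ->
    proper_coloring f -> (m <= b ^ c)%N -> Defs.covered_by (chif_le beta) G c.
Proof.
move=> beta1 bbeta pf mbc.
have le_m : (m <= #|{ffun 'I_c -> 'I_b}|)%N by rewrite card_ffun !card_ord.
pose digits v := enum_val (widen_ord le_m (f v)).
pose adj_at (i : 'I_c) (x y : G) := adj x y && (digits x i != digits y i).
have adj_at_sym i : symmetric (adj_at i).
  by move=> x y; rewrite /adj_at adj_sym eq_sym.
have adj_atP i x y : adj_at i x y ->
    [&& x \in [set: G]%SET, y \in [set: G]%SET & adj x y].
  by case/andP => xy _; rewrite !inE.
exists (fun i => Subgraph (adj_at_sym i) (adj_atP i)); split=> [i|x y].
  rewrite /chif_le; set H := graph_of_subgraph _.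
  have [eH|] := boolP (has_edge H); last first.
    rewrite /fractional_chromatic_number => /negbTE->.
    by apply: le_trans beta1; case: (0 < _)%N.
  apply: le_trans bbeta; rewrite -[leRHS]divr1 -[b in leRHS]card_ord.
  apply: (@chif_le_ratio H _ 1 (fun v : H => [set digits (val v) i])) => //.
  split=> [v|u v]; first exact: cards1.
  by move=> /andP[_ uv]; rewrite disjoints1 inE.
split=> [xy|[i /andP[]//]].
apply: contrapT => nex; have := pf x y xy; apply/negP; rewrite negbK.
have /enum_val_inj/(congr1 val) exy : digits x = digits y.
  apply/ffunP => i; apply/eqP; apply: contrapT => /negP ne; apply: nex.
  by exists i; rewrite /= /adj_at xy.
exact/eqP/val_inj.
Qed.

(** * Chromatic number and cover number *)

Lemma chromatic_number_attained (G : graph) :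
  exists f : G -> 'I_(chromatic_number G), proper_coloring f.
Proof.
have ex : exists m, `[<exists f : G -> 'I_m, proper_coloring f>].
  exists #|G|; apply/asboolP; exists enum_rank => x y xy.
  rewrite (inj_eq enum_rank_inj).
  by apply: contraTneq xy => ->; rewrite adj_irr.
case: (ex_minnP ex) => m /asboolP cm mmin.
rewrite /chromatic_number (@least_eq _ _ _ m)//= => p pp.
by apply: mmin; apply/asboolP.
Qed.

Lemma clique_number_le_chromatic (G : graph) :
  (clique_number G <= chromatic_number G)%N.
Proof.
have [f pf] := chromatic_number_attained G.
apply/bigmax_leqP => A /forall_inP cA; rewrite -[leqRHS]card_ord.
rewrite -(@card_in_imset _ _ f A) ?max_card// => x y xA yA fxy.
apply/eqP/negPn/negP => xy.
have /forall_inP/(_ y yA)/implyP/(_ xy) := cA x xA.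
by move/pf; rewrite fxy eqxx.
Qed.

Lemma cover_number_le (P : graph -> Prop) (G : graph) (c : nat) :
    (0 < c)%N -> Defs.covered_by P G c ->
  Defs.covered_by P G (cover_number P G) /\ (cover_number P G <= c)%N.
Proof.
move=> c0 Pc.
have ex : exists m, `[<(0 < m)%N /\ Defs.covered_by P G m>].
  by exists c; apply/asboolP.
case: (ex_minnP ex) => m /asboolP[m0 cm] mmin.
have -> : cover_number P G = m.
  rewrite /cover_number (@least_eq _ _ _ m)//= => p pp.
  by apply: mmin; apply/asboolP.
by split=> //; apply: mmin; apply/asboolP.
Qed.

(** * The two bounds *)

Theorem theorem1p3 (R : realType) (G : graph) (hG : has_edge G)
    (beta : rat) (hbeta : 2 < beta) :
  Num.ceil (log2 (ratr (fractional_chromatic_number G) : R)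
            / log2 (ratr beta : R))
    <= (cover_number (chif_le beta) G)%:Z
    <= Num.ceil (log2 ((chromatic_number G)%:R : R)
                 / log2 ((clique_number G)%:R : R))
       * Num.ceil (log2 (ratr (fractional_chromatic_number G) : R)
                   / log2 ((Num.floor beta)%:~R : R)).
Proof.
have log2_ratio (x y : R) : log2 x / log2 y = ln x / ln y.
  by rewrite /log2 -mulf_div divff ?mulr1// invr_eq0 gt_eqF// ln_gt0// ltr1n.
rewrite !log2_ratio.
have b1 : 1 <= beta by lra.
have [b bE] : exists b : nat, Num.floor beta = b%:Z.
  have : 0 <= Num.floor beta by rewrite floor_ge0; lra.
  by case: (Num.floor beta) => // b _; exists b.
have b2 : (2 <= b)%N by rewrite -(lez_nat 2) -bE floor_ge_int ltW.
have bbeta : b%:R <= beta by have := floor_le beta; rewrite bE.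
rewrite bE; set chif := fractional_chromatic_number G.
have chif2 : 2 <= chif := chif_ge2 hG.
have chifR : 2 <= ratr chif :> R by rewrite -(ratr_nat R 2) ler_rat.
have betaR : 2 < ratr beta :> R by rewrite -(ratr_nat R 2) ltr_rat.
have omega2 := clique_number_ge2 hG.
have omegaR : 2 <= (clique_number G)%:R :> R by rewrite ler_nat.
have omega_chif : (clique_number G)%:R <= ratr chif :> R.
  by rewrite -ratr_nat ler_rat clique_number_le_chif.
have chiR : 2 <= (chromatic_number G)%:R :> R.
  by rewrite ler_nat (leq_trans omega2) ?clique_number_le_chromatic.
have bR : 2 <= b%:R :> R by rewrite ler_nat.
set u := Num.ceil (ln (chromatic_number G)%:R / _ : R).
set v := Num.ceil (ln (ratr chif) / ln b%:~R : R).
have ln_pos (x : R) : 2 <= x -> 0 < ln x by move=> ?; apply: ln_gt0; lra.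
have u0 : 0 < u by rewrite ceil_gt0 divr_gt0// ln_pos.
have v0 : 0 < v by rewrite ceil_gt0 divr_gt0// ln_pos.
have [c cE] : exists c : nat, u * v = c%:Z.
  have : 0 <= u * v by rewrite mulr_ge0 ?ltW.
  by case: (u * v) => // c _; exists c.
have c0 : (0 < c)%N by rewrite -ltz_nat -cE mulr_gt0.
have chi_le : (chromatic_number G <= b ^ c)%N.
  rewrite -(ler_nat R) natrX -ler_ln ?posrE ?exprn_gt0//; try lra.
  rewrite lnXn; last lra.
  have -> : ln (b%:R : R) *+ c = (u * v)%:~R * ln b%:R.
    by rewrite cE -[LHS]mulr_natl.
  rewrite intrM -mulrA.
  (* bound [chi] by a power of [omega], and [omega], through [chif], by a power
     of [b] *)
  have ln_chi :
      ln (chromatic_number G)%:R <= u%:~R * ln (clique_number G)%:R :> R.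
    by rewrite -ler_pdivrMr ?ln_pos//; exact: ceil_ge.
  have ln_chif : ln (ratr chif : R) <= v%:~R * ln b%:R.
    by rewrite -ler_pdivrMr ?ln_pos//; exact: ceil_ge.
  apply: le_trans ln_chi _; apply: ler_wpM2l; first by rewrite ler0z ltW.
  by apply: le_trans ln_chif; rewrite ler_ln ?posrE//; lra.
have [f pf] := chromatic_number_attained G.
have [cov cov_le] := cover_number_le c0 (covered_by_digits b1 bbeta pf chi_le).
apply/andP; split; last by rewrite cE lez_nat.
rewrite ceil_le_int ler_pdivrMr; last by apply: ln_pos; lra.
have := chif_le_expn_cover hG b1 cov.
rewrite -(ler_rat R) rmorphXn/= -ler_ln ?posrE ?exprn_gt0//; try lra.
by rewrite lnXn ?mulr_natl//; lra.
Qed.
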